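(* For the wheel $W_n$ of order $n+1\geq 4$, $\gamma_{tm}(W_n)=\lceil n/2\rceil+1$.
   Context: $W_n$ is the wheel of order $n+1$: it has vertices $v_0,v_1,\dots,v_n$ and edges $v_0v_i$ and $v_iv_{i+1}$ for $1\leq i\leq n$, where $v_{n+1}$ means $v_1$. A total mixed dominating set of a finite simple graph $G=(V,E)$ with minimum degree at least $1$ is a set $S\subseteq V\cup E$ such that every element of $V\cup E$ (including those in $S$) is adjacent or incident to an element of $S$ (two vertices are adjacent if joined by an edge; two distinct edges are adjacent if they share an endpoint; a vertex and an edge are incident if the vertex is an endpoint of the edge; no element is adjacent or incident to itself). The total mixed domination number $\gamma_{tm}(G)$ is the minimum cardinality of a total mixed dominating set. *)

(* Defs.v *)
From mathcomp Require Import all_boot.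

Set Implicit Arguments.
Unset Strict Implicit.
Unset Printing Implicit Defensive.

Record sgraph := SGraph {
  vertex :> finType;
  adj : rel vertex;
  adj_sym : symmetric adj;
  adj_irrefl : irreflexive adj }.

Definition is_edge (G : sgraph) (s : {set G}) : bool :=
  [exists x : G, [exists y : G, adj x y && (s == [set x; y])]].

Notation edge G := {s : {set G} | is_edge s}.

(* The disjoint union of the vertex set and the edge set. *)
Definition element (G : sgraph) : finType := (vertex G + edge G)%type.

Definition adj_or_inc (G : sgraph) (a b : element G) : bool :=
  match a, b with
  | inl x, inl y => adj x y
  | inl x, inr e => x \in val e
  | inr e, inl x => x \in val e
  | inr e, inr f => (e != f) && (val e :&: val f != set0)
  end.

Definition total_mixed_dominating (G : sgraph) (S : {set element G}) : bool :=
  [forall a : element G, [exists b in S, adj_or_inc a b]].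

Definition min_degree_ge1 (G : sgraph) : Prop :=
  forall x : G, exists y : G, adj x y.

(* [setT] is only the seed of the minimisation: it is total mixed dominating
   exactly when there is no isolated vertex, and the value is meaningful only
   then (see [gamma_tmP]). *)
Definition gamma_tm (G : sgraph) : nat :=
  #|[arg min_(S < [set: element G] | total_mixed_dominating S) #|S| ]|.

Lemma total_mixed_dominating_setT (G : sgraph) :
  min_degree_ge1 G -> total_mixed_dominating [set: element G].
Proof.
move=> degG; apply/forallP => -[x|e]; apply/existsP.
  by have [y xy] := degG x; exists (inl y); rewrite inE.
have /existsP[x /existsP[y /andP[_ /eqP De]]] := valP e.
by exists (inl x); rewrite inE /= De set21.
Qed.

Lemma gamma_tmP (G : sgraph) : min_degree_ge1 G ->
  (exists2 S : {set element G}, total_mixed_dominating S & #|S| = gamma_tm G)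
  /\ (forall S : {set element G}, total_mixed_dominating S ->
        gamma_tm G <= #|S|).
Proof.
move=> /total_mixed_dominating_setT domT; rewrite /gamma_tm.
by case: arg_minnP => // S domS minS; split; first exists S.
Qed.

(* The vertex [v_i] is [i : 'I_n.+1]: [0] is the hub and [1, ..., n] is the
   rim, on which the successor of [n] is [1]. *)
Definition rim_succ (n i : nat) : nat := if i == n then 1 else i.+1.

Definition wheel_arc (n : nat) (i j : 'I_n.+1) : bool :=
  ((i == 0 :> nat) && (0 < j)) || ((0 < i) && (j == rim_succ n i :> nat)).

(* For [2 <= n] no arc is a loop, so [i != j] removes nothing there. *)
Definition wheel_adj (n : nat) : rel 'I_n.+1 :=
  [rel i j | (i != j) && (wheel_arc i j || wheel_arc j i)].

Lemma wheel_adj_sym (n : nat) : symmetric (@wheel_adj n).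
Proof. by move=> i j; rewrite /wheel_adj /= eq_sym orbC. Qed.

Lemma wheel_adj_irrefl (n : nat) : irreflexive (@wheel_adj n).
Proof. by move=> i; rewrite /wheel_adj /= eqxx. Qed.

Definition wheel (n : nat) : sgraph :=
  SGraph (@wheel_adj_sym n) (@wheel_adj_irrefl n).

Lemma wheel_min_degree_ge1 (n : nat) : 0 < n -> min_degree_ge1 (wheel n).
Proof.
move=> n_gt0 x; have [x0|x_gt0] := posnP x.
  by exists ord_max; rewrite /= /wheel_adj /= /wheel_arc -val_eqE /= x0 n_gt0 ltn_eqF.
by exists ord0; rewrite /= /wheel_adj /= /wheel_arc -val_eqE /= x_gt0 gtn_eqF // orbT.
Qed.

(* Main.v *)
Require Import Defs.
From mathcomp Require Import all_boot zify.

(** The hub together with the rim vertices of odd label is a total mixed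
    dominating set of cardinality [uphalf n + 1]: the hub dominates all rim
    vertices and all spokes, a rim vertex dominates the hub, and every rim edge
    has an end of odd label ([hub_and_odd_rim_dominating]).

    For the converse, let [S] dominate, and let [a], [b], [c] be the numbers of
    rim vertices, rim edges and spokes in [S]. It suffices to show
    [n + 2 <= 2 |S|]. Each of these elements dominates two rim edges, and
    the hub dominates none, so [n <= 2 (a + b + c)]. If the hub is in [S], this
    is enough. Otherwise the hub must be dominated by a rim vertex or a spoke,
    so [1 <= a + c], and there are two cases.

    - No spoke is in [S]. A rim vertex then dominates one spoke and a rim edge
      two, so [n <= a + 2 b]. If no rim edge is in [S], then [n <= a], which
      suffices. If some rim edge is in [S], whatever dominates it
      shares with it an end whose spoke is dominated twice. Hence
      [n + 1 <= a + 2 b], and [1 <= a] gives [n + 2 <= 2 (a + b)].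
    - Some spoke is in [S]. Rim vertices and rim edges dominate two rim
      vertices each, spokes only one, so [n <= 2 a + 2 b + c]; two spokes are
      thus enough. A single spoke, with rim end [v], is dominated by a rim edge
      at [v] or by [v]. In the first case [v] is dominated twice, so
      [n + 1 <= 2 a + 2 b + c]. In the second case the spoke dominates only
      rim edges that [v] dominates too, so already [n <= 2 (a + b)].

    This argument speaks only of the cyclic order of the rim, and
    [cycle_domination_bound] is its formulation there. The remaining work is to
    name the elements of the wheel by indices in ['I_n] and to read off which
    ones can dominate a given one. *)

Set Implicit Arguments.
Unset Strict Implicit.
Unset Printing Implicit Defensive.

(** * Covering inequalities on a cycle *)

Lemma sum_mem_inj (T : finType) (f : T -> T) (A : {set T}) :
  injective f -> \sum_i (f i \in A) = #|A|.
Proof.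
move=> /injF_bij bijf; rewrite -sum1_card [RHS]big_mkcond /=.
rewrite [RHS](reindex f) /=; last exact: onW_bij.
by apply: eq_bigr => i _; case: (f i \in A).
Qed.

Lemma cover_card (T : finType) (F : T -> nat) :
  (forall i, 0 < F i) -> #|T| <= \sum_i F i.
Proof.
by move=> F_gt0; rewrite -sum1_card; apply: leq_sum => i _; exact: F_gt0.
Qed.

Lemma cover_twice_card (T : finType) (F : T -> nat) (j : T) :
  (forall i, 0 < F i) -> 1 < F j -> #|T|.+1 <= \sum_i F i.
Proof.
move=> F_gt0 Fj; rewrite (bigD1 j) //= -sum1_card (bigD1 j) //= -addSn.
by apply: leq_add => //; apply: leq_sum => i _; exact: F_gt0.
Qed.

(** The counting argument for the lower bound. For the wheel, [T] indexes the
    rim, [s] and [p] are the cyclic successor and predecessor, [h] tells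
    whether the hub is selected, and [A], [B], [C] index the selected rim
    vertices, rim edges (edge [i] joins [i] to
    [s i]) and spokes. The hypotheses are domination of the hub, the rim edges,
    the rim vertices and the spokes; the last two say something only in the
    absence of the hub, which dominates all of these elements. *)
Lemma cycle_domination_bound (T : finType) (s p : T -> T) (h : bool)
    (A B C : {set T}) :
  cancel s p -> cancel p s -> 1 < #|T| ->
  (exists i, (i \in A) || (i \in C)) ->
  (forall i, [|| i \in A, s i \in A, p i \in B, s i \in B, i \in C
               | s i \in C]) ->
  (~~ h -> forall i,
     [|| p i \in A, s i \in A, i \in B, p i \in B | i \in C]) ->
  (~~ h -> forall i, [|| i \in A, i \in B, p i \in B
                       | [exists j in C, j != i]]) ->
  #|T| + 2 <= (h + #|A| + #|B| + #|C|).*2.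
Proof.
set N := #|T| => sK pK N_gt1 hubP rimP vtxP spkP.
have leN (F : T -> nat) : (forall i, 0 < F i) -> N <= \sum_i F i.
  exact: cover_card.
have ltN (F : T -> nat) j : (forall i, 0 < F i) -> 1 < F j -> N < \sum_i F i.
  exact: cover_twice_card.
have s_inj := can_inj sK; have p_inj := can_inj pK.
have idE (D : {set T}) : \sum_i (i \in D) = #|D|.
  exact: (@sum_mem_inj _ id).
have sumE := (idE, fun D => sum_mem_inj D s_inj, fun D => sum_mem_inj D p_inj).
(* [E i] counts the rim vertices and rim edges that dominate rim edge [i]. *)
pose E i := (i \in A) + (s i \in A) + (p i \in B) + (s i \in B).
have sum_E : \sum_i E i = #|A| + #|A| + #|B| + #|B|.
  by rewrite !big_split /= !sumE.
have rim_le : N <= \sum_i (E i + (i \in C) + (s i \in C)).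
  by apply: leN => i; move: (rimP i); rewrite /E; lia.
move: rim_le; rewrite 2!big_split /= sum_E !sumE => rim_le.
case: h vtxP spkP => [_ _|/(_ isT) vtxP /(_ isT) spkP]; first lia.
have [C0|[j jC]] := set_0Vmem C.
  subst C; rewrite cards0.
  have A_gt0 : 0 < #|A|.
    by have [i] := hubP; rewrite inE orbF => iA; apply/card_gt0P; exists i.
  (* No spoke being selected, [F i] counts the dominators of spoke [i]. *)
  pose F i := (i \in A) + (i \in B) + (p i \in B).
  have F_gt0 i : 0 < F i.
    have := spkP i; rewrite /F.
    have -> : [exists j in set0, j != i] = false.
      by apply/existsP => -[k]; rewrite inE.
    lia.
  have sumF : \sum_i F i = #|A| + #|B| + #|B| by rewrite !big_split /= !sumE.
  have [B0|[k kB]] := set_0Vmem B.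
    by have := leN F F_gt0; rewrite sumF B0 cards0; lia.
  (* A dominator of rim edge [k] meets it in [k] or [s k], and the spoke there
     is dominated by both. *)
  suff [l Fl] : exists l, 1 < F l.
    by have := ltN F _ F_gt0 Fl; rewrite sumF; lia.
  have := rimP k; rewrite !inE !orbF => /or4P[] kD.
  - by exists k; rewrite /F kD kB.
  - by exists (s k); rewrite /F sK kD kB; lia.
  - by exists k; rewrite /F kD kB; lia.
  - by exists (s k); rewrite /F sK kD kB; lia.
(* [F i] counts the dominators of rim vertex [i]. *)
pose F i := (p i \in A) + (s i \in A) + (i \in B) + (p i \in B) + (i \in C).
have F_gt0 i : 0 < F i by move: (vtxP i); rewrite /F; lia.
have sumF : \sum_i F i = #|A| + #|A| + #|B| + #|B| + #|C|.
  by rewrite !big_split /= !sumE.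
have [C_gt1|C_le1] := ltnP 1 #|C|.
  by have := leN F F_gt0; rewrite sumF; lia.
have C1 : C = [set j].
  by apply/eqP; rewrite eq_sym eqEcard sub1set jC cards1.
have F_j_gt1 : (j \in B) || (p j \in B) -> 1 < F j.
  by rewrite /F jC; lia.
have [jB|/norP[jNB pjNB]] := boolP ((j \in B) || (p j \in B)).
  by have := ltN F _ F_gt0 (F_j_gt1 jB); rewrite sumF C1 cards1; lia.
have jA : j \in A.
  have := spkP j; rewrite (negPf jNB) (negPf pjNB) /=.
  by case/orP=> // /existsP[k]; rewrite C1 inE => /andP[-> ].
(* The only spoke has its rim end in [A], so it can be discarded without
   leaving a rim edge undominated. *)
have CA i : i \in C -> i \in A by rewrite C1 inE => /eqP->.
have : N <= \sum_i E i.
  apply: leN => i.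
  by move: (rimP i) (CA i) (CA (s i)); rewrite /E; lia.
by rewrite sum_E C1 cards1; lia.
Qed.

(** * Vertices and edges of the wheel *)

(** Rim indices start at [0], one less than the label of the vertex, so that
    the cyclic successor on the rim is [ordS]. The order is [m.+3] because the
    rim is a simple cycle only from length three on. *)
Definition rim_vertex (m : nat) (i : 'I_m.+3) : wheel m.+3 := lift ord0 i.

Lemma rim_vertex_inj (m : nat) : injective (@rim_vertex m).
Proof. exact: lift_inj. Qed.

Lemma rim_vertex_eq (m : nat) (i j : 'I_m.+3) :
  (rim_vertex i == rim_vertex j) = (i == j).
Proof. exact: inj_eq (@rim_vertex_inj m) _ _. Qed.

Lemma hub_adj (m : nat) (i : 'I_m.+3) :
  @adj (wheel m.+3) ord0 (rim_vertex i).
Proof. by []. Qed.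

Lemma ordSE (m : nat) (i : 'I_m.+3) :
  ordS i = (if i == m.+2 :> nat then 0 else i.+1) :> nat.
Proof.
rewrite /=; case: eqP => [->|im]; first by rewrite modnn.
by rewrite modn_small //; have := ltn_ord i; lia.
Qed.

Lemma ordS_neq (m : nat) (i : 'I_m.+3) : ordS i != i.
Proof.
by apply/eqP => /(congr1 (@nat_of_ord _)); rewrite ordSE; case: eqP; lia.
Qed.

Lemma ordSS_neq (m : nat) (i : 'I_m.+3) : ordS (ordS i) != i.
Proof.
apply/eqP => /(congr1 (@nat_of_ord _)); rewrite !ordSE.
by do 2?case: eqP; lia.
Qed.

Lemma rim_adj (m : nat) (i j : 'I_m.+3) :
  adj (rim_vertex i) (rim_vertex j) = (j == ordS i) || (i == ordS j).
Proof.
have succE (k l : 'I_m.+3) :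
    (lift ord0 l == rim_succ m.+3 (lift ord0 k) :> nat) = (l == ordS k).
  rewrite -(inj_eq val_inj) [val (ordS k)]ordSE /rim_succ !lift0 eqSS.
  by case: ifP => _; rewrite eqSS.
rewrite /rim_vertex /= /wheel_adj /= /wheel_arc !succE !lift0 /=.
rewrite (inj_eq (@lift_inj _ ord0)).
have [->|//] := eqVneq i j.
by rewrite eq_sym (negPf (ordS_neq j)).
Qed.

Lemma rim_succ_adj (m : nat) (i : 'I_m.+3) :
  adj (rim_vertex i) (rim_vertex (ordS i)).
Proof. by rewrite rim_adj eqxx. Qed.

Lemma is_edge_adj (G : sgraph) (x y : G) : adj x y -> is_edge [set x; y].
Proof.
by move=> xy; apply/existsP; exists x; apply/existsP; exists y; rewrite xy /=.
Qed.

Definition edge_of (G : sgraph) (x y : G) (xy : adj x y) : edge G :=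
  exist _ [set x; y] (is_edge_adj xy).

Definition spoke (m : nat) (i : 'I_m.+3) : edge (wheel m.+3) :=
  edge_of (hub_adj i).

Definition rim_edge (m : nat) (i : 'I_m.+3) : edge (wheel m.+3) :=
  edge_of (rim_succ_adj i).

Variant vertex_spec (m : nat) : wheel m.+3 -> Prop :=
  | VertexHub : vertex_spec ord0
  | VertexRim i : vertex_spec (rim_vertex i).

Lemma vertexP (m : nat) (x : wheel m.+3) : vertex_spec x.
Proof.
have [i ->|->] := unliftP (ord0 : wheel m.+3) x; last exact: VertexHub.
exact: (VertexRim i).
Qed.

Variant edge_spec (m : nat) : edge (wheel m.+3) -> Prop :=
  | EdgeSpoke i : edge_spec (spoke i)
  | EdgeRim i : edge_spec (rim_edge i).

Lemma edgeP (m : nat) (e : edge (wheel m.+3)) : edge_spec e.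
Proof.
have /existsP[x /existsP[y /andP[xy /eqP De]]] := valP e.
case: (vertexP x) (vertexP y) xy De => [|i] [|j].
- by rewrite adj_irrefl.
- by move=> _ De; have -> : e = spoke j; [exact: val_inj|exact: EdgeSpoke].
- move=> _; rewrite setUC => De.
  by have -> : e = spoke i; [exact: val_inj|exact: EdgeSpoke].
rewrite rim_adj => /orP[] /eqP->; last rewrite setUC => De.
  by move=> De; have -> : e = rim_edge i; [exact: val_inj|exact: EdgeRim].
by have -> : e = rim_edge j; [exact: val_inj|exact: EdgeRim].
Qed.

Lemma hub_spoke (m : nat) (i : 'I_m.+3) : ord0 \in val (spoke i).
Proof. by rewrite set21. Qed.

Lemma hub_rim_edge (m : nat) (i : 'I_m.+3) : ord0 \notin val (rim_edge i).
Proof. by rewrite !inE. Qed.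

Lemma rim_vertex_spoke (m : nat) (i j : 'I_m.+3) :
  (rim_vertex i \in val (spoke j)) = (i == j).
Proof. by rewrite !inE rim_vertex_eq. Qed.

Lemma rim_vertex_rim_edge (m : nat) (i j : 'I_m.+3) :
  (rim_vertex i \in val (rim_edge j)) = (i == j) || (i == ordS j).
Proof. by rewrite !inE !rim_vertex_eq. Qed.

Definition incE :=
  (hub_spoke, hub_rim_edge, rim_vertex_spoke, rim_vertex_rim_edge).

Lemma spoke_inj (m : nat) : injective (@spoke m).
Proof.
by move=> i j eq_ij; apply/eqP; rewrite -rim_vertex_spoke -eq_ij incE.
Qed.

(** Two rim edges with the same ends could only be [{i, i + 1}] and
    [{i + 1, i + 2}] with [i + 2 = i], which a rim of length at least three
    rules out. *)
Lemma rim_edge_inj (m : nat) : injective (@rim_edge m).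
Proof.
move=> i j eq_ij.
have := rim_vertex_rim_edge i j; have := rim_vertex_rim_edge (ordS i) j.
rewrite -eq_ij !incE !eqxx orbT /= => Si /esym/orP[/eqP//|/eqP ij].
move: Si; rewrite ij (negPf (ordSS_neq j)) /=.
by rewrite (inj_eq (can_inj (@ordSK _))) (negPf (ordS_neq j)).
Qed.

(** * The lower bound *)

Lemma rim_edge_dominated (m : nat) (S : {set element (wheel m.+3)}) i :
  [exists b in S, adj_or_inc (inr (rim_edge i)) b] ->
  [|| inl (rim_vertex i) \in S, inl (rim_vertex (ordS i)) \in S,
      inr (rim_edge (ord_pred i)) \in S, inr (rim_edge (ordS i)) \in S,
      inr (spoke i) \in S | inr (spoke (ordS i)) \in S].
Proof.
move=> /existsP[[x|f] /andP[bS /=]].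
  case: (vertexP x) bS => [|j] bS; rewrite ?(negPf (hub_rim_edge i)) //.
  by rewrite incE => /orP[] /eqP Dj; subst j; rewrite bS ?orbT.
case: (edgeP f) bS => j bS /andP[ne_f /set0Pn[x /setIP[]]].
  case: (vertexP x) => [|k]; first by rewrite (negPf (hub_rim_edge i)).
  rewrite !incE => + /eqP Dk; subst k.
  by case/orP=> /eqP Dj; subst j; rewrite bS ?orbT.
case: (vertexP x) => [|k]; first by rewrite (negPf (hub_rim_edge i)).
rewrite !incE => /orP[] /eqP-> /orP[] /eqP Dj.
- by rewrite Dj eqxx in ne_f.
- by rewrite Dj ordSK bS !orbT.
- by rewrite Dj bS !orbT.
- by rewrite (can_inj (@ordSK _) Dj) eqxx in ne_f.
Qed.

Lemma rim_vertex_dominated (m : nat) (S : {set element (wheel m.+3)}) i :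
  inl ord0 \notin S ->
  [exists b in S, adj_or_inc (inl (rim_vertex i)) b] ->
  [|| inl (rim_vertex (ord_pred i)) \in S, inl (rim_vertex (ordS i)) \in S,
      inr (rim_edge i) \in S, inr (rim_edge (ord_pred i)) \in S
    | inr (spoke i) \in S].
Proof.
move=> hubNS /existsP[[x|f] /andP[bS]].
  case: (vertexP x) bS => [|j] bS; first by rewrite bS in hubNS.
  rewrite /adj_or_inc rim_adj => /orP[] /eqP Dj.
    by rewrite -Dj bS orbT.
  by rewrite Dj ordSK bS.
case: (edgeP f) bS => j bS /=; rewrite incE.
  by move/eqP->; rewrite bS !orbT.
by case/orP=> /eqP->; rewrite ?ordSK bS !orbT.
Qed.

Lemma spoke_dominated (m : nat) (S : {set element (wheel m.+3)}) i :
  inl ord0 \notin S ->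
  [exists b in S, adj_or_inc (inr (spoke i)) b] ->
  [|| inl (rim_vertex i) \in S, inr (rim_edge i) \in S,
      inr (rim_edge (ord_pred i)) \in S
    | [exists j in [set j | inr (spoke j) \in S], j != i]].
Proof.
move=> hubNS /existsP[[x|f] /andP[bS /=]].
  case: (vertexP x) bS => [|j] bS; first by rewrite bS in hubNS.
  by rewrite incE => /eqP <-; rewrite bS.
case: (edgeP f) bS => j bS /andP[ne_f].
  move=> _; apply/or4P/Or44/existsP; exists j; rewrite inE bS /=.
  by apply: contraNneq ne_f => ->.
move=> /set0Pn[x /setIP[]].
case: (vertexP x) => [|k]; first by rewrite (negPf (hub_rim_edge j)).
rewrite !incE => /eqP<- /orP[] /eqP->; first by rewrite bS orbT.
by rewrite ordSK bS !orbT.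
Qed.

Lemma hub_dominated (m : nat) (S : {set element (wheel m.+3)}) :
  [exists b in S, adj_or_inc (inl (ord0 : wheel m.+3)) b] ->
  exists i : 'I_m.+3, (inl (rim_vertex i) \in S) || (inr (spoke i) \in S).
Proof.
move=> /existsP[[x|f] /andP[bS]].
  by case: (vertexP x) bS => [|j] bS //; exists j; rewrite bS.
case: (edgeP f) bS => j bS /=; first by exists j; rewrite bS orbT.
by rewrite (negPf (hub_rim_edge j)).
Qed.

(** The four families name distinct elements: vertices are separated from
    edges by type, spokes from rim edges by containing the hub. *)
Lemma card_wheel_elements (m : nat) (S : {set element (wheel m.+3)}) :
  (inl ord0 \in S) + #|[set i | inl (@rim_vertex m i) \in S]|
  + #|[set i | inr (@rim_edge m i) \in S]|
  + #|[set i | inr (@spoke m i) \in S]| <= #|S|.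
Proof.
set A := [set i | inl _ \in S]; set B := [set i | inr (rim_edge _) \in S].
set C := [set i | _].
have -> : #|S| = \sum_(x : wheel m.+3) (inl x \in S)
                 + \sum_(e : edge (wheel m.+3)) (inr e \in S).
  rewrite -sum1_card big_mkcond [LHS]big_sumType /=.
  by congr (_ + _); apply: eq_bigr => x _; case: ifP.
rewrite big_ord_recl -!addnA !leq_add2l; apply: leq_add.
  by rewrite -sum1_card big_mkcond; apply: leq_sum => i _; rewrite inE.
have -> : \sum_(e : edge (wheel m.+3)) (inr e \in S)
          = #|[set e : edge (wheel m.+3) | inr e \in S]|.
  by rewrite -sum1_card [RHS]big_mkcond; apply: eq_bigr => e _; rewrite inE.
rewrite -(card_imset B (@rim_edge_inj m)) -(card_imset C (@spoke_inj m)).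
have disBC : [disjoint @rim_edge m @: B & @spoke m @: C].
  apply/pred0P => e /=; apply/negP => /andP[/imsetP[i _ ->] /imsetP[j _ eq_ij]].
  by have := hub_rim_edge i; rewrite eq_ij hub_spoke.
have /eqP<- : #|@rim_edge m @: B :|: @spoke m @: C| == _ :=
  etrans (leq_card_setU _ _).2 disBC.
apply/subset_leq_card/subsetP => e; rewrite inE [e \in [set _ | _]]inE.
by case/orP=> /imsetP[i iS ->]; rewrite inE in iS.
Qed.

Lemma total_mixed_dominating_wheel_ge (m : nat)
    (S : {set element (wheel m.+3)}) :
  total_mixed_dominating S -> uphalf m.+3 + 1 <= #|S|.
Proof.
move=> /forallP domS; apply: leq_trans (card_wheel_elements S).
suff : #|'I_m.+3| + 2 <= ((inl ord0 \in S)
  + #|[set i | inl (@rim_vertex m i) \in S]|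
  + #|[set i | inr (@rim_edge m i) \in S]|
  + #|[set i | inr (@spoke m i) \in S]|).*2 by rewrite card_ord; lia.
apply: (@cycle_domination_bound _ (@ordS _) (@ord_pred _)).
- exact: ordSK.
- exact: ord_predK.
- by rewrite card_ord.
- by have [i iS] := hub_dominated (domS _); exists i; rewrite !inE.
- by move=> i; rewrite !inE; exact: rim_edge_dominated.
- by move=> hubNS i; rewrite !inE; exact: rim_vertex_dominated.
- by move=> hubNS i; rewrite !inE; exact: spoke_dominated.
Qed.

(** * The upper bound *)

(** Odd labels are even rim indices. The first and the last rim vertex are
    both taken when [n] is odd, which accounts for the rounding up. *)
Definition hub_and_odd_rim (m : nat) : {set element (wheel m.+3)} :=
  [set inl x | x : 'I_m.+4 & (x == ord0) || odd x].

Lemma card_even_ord (n : nat) : \sum_(i < n) ~~ odd i = uphalf n.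
Proof.
by elim: n => [|n IHn]; rewrite ?big_ord0 // big_ord_recr /= IHn; lia.
Qed.

Lemma card_hub_and_odd_rim (m : nat) :
  #|hub_and_odd_rim m| = uphalf m.+3 + 1.
Proof.
rewrite card_imset; last by move=> x y [].
rewrite -sum1_card big_mkcond big_ord_recl inE eqxx addn1.
rewrite -card_even_ord /= add1n.
by congr _.+1; apply: eq_bigr => i _; rewrite inE lift0 /=; case: odd.
Qed.

Lemma hub_in_hub_and_odd_rim (m : nat) : inl ord0 \in hub_and_odd_rim m.
Proof. by apply/imsetP; exists ord0; rewrite // inE eqxx. Qed.

Lemma rim_vertex_in_hub_and_odd_rim (m : nat) (i : 'I_m.+3) :
  ~~ odd i -> inl (rim_vertex i) \in hub_and_odd_rim m.
Proof.
move=> i_even; apply/imsetP; exists (rim_vertex i) => //.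
by rewrite inE lift0 /= i_even.
Qed.

(** On an odd rim the parities do not alternate at the edge that closes the
    cycle, but this edge ends in index [0], which is even. *)
Lemma rim_edge_even_end (m : nat) (i : 'I_m.+3) : ~~ odd i || ~~ odd (ordS i).
Proof. by rewrite ordSE; case: eqP => //=; case: odd. Qed.

Lemma hub_and_odd_rim_dominating (m : nat) :
  total_mixed_dominating (hub_and_odd_rim m).
Proof.
have hubS := hub_in_hub_and_odd_rim m.
apply/forallP => -[x|e]; apply/existsP.
  case: (vertexP x) => [|i]; last first.
    by exists (inl ord0); rewrite hubS /adj_or_inc adj_sym hub_adj.
  by exists (inl (rim_vertex ord0)); rewrite rim_vertex_in_hub_and_odd_rim.
case: (edgeP e) => i; first by exists (inl ord0); rewrite hubS /= hub_spoke.
have /orP[ev|ev] := rim_edge_even_end i.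
  exists (inl (rim_vertex i)).
  by rewrite rim_vertex_in_hub_and_odd_rim //= incE eqxx.
exists (inl (rim_vertex (ordS i))).
by rewrite rim_vertex_in_hub_and_odd_rim //= incE eqxx orbT.
Qed.

Theorem proposition3p8 (n : nat) (hn : 4 <= n.+1) :
  gamma_tm (wheel n) = uphalf n + 1.
Proof.
case: n hn => [|[|[|m]]] // _.
have [[S domS <-] min_gamma] := gamma_tmP (@wheel_min_degree_ge1 m.+3 isT).
apply/eqP; rewrite eqn_leq total_mixed_dominating_wheel_ge // andbT.
by rewrite -card_hub_and_odd_rim min_gamma // hub_and_odd_rim_dominating.
Qed.
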